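(* Let $\omega:\mathbb{C}\to\mathbb{C}$ be an entire function such that $\operatorname{Im}\omega(k)\le|\operatorname{Im} k|$ for all $k\in\mathbb{C}$. Then $\omega$ is a polynomial of degree at most one. *)

(* Defs.v *)
From Stdlib Require Export Reals.
From Coquelicot Require Export Coquelicot.

(* Complex differentiability: the module instance is forced because Coquelicot
   would otherwise be free to read C as a product of real lines. *)
Definition entire (f : C -> C) : Prop :=
  forall z : C, @ex_derive C_AbsRing C_NormedModule f z.

(* [sum_n] has n + 1 terms; the leading coefficient may vanish, so the zero
   polynomial is included. *)
Definition polynomial_degree_le (n : nat) (f : C -> C) : Prop :=
  exists a : nat -> C,
    forall z : C, f z = @sum_n C_Ring (fun i => Cmult (a i) (Cpow z i)) n.

(* Main.v *)
(* Writing omega = u + i v and M = |Im a| + r, the function M - v is nonnegative on the circle of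
   centre a and radius r. Its mean is M - v(a) and its first Fourier coefficients are, up to
   sign, r/2 times the real and imaginary parts of omega'(a); so |Re omega'| and |Im omega'| are
   bounded by 2, and v is Lipschitz. Comparing the first Fourier coefficients on circles with two
   different centres and letting r tend to infinity then shows that omega' is constant.
   The Fourier coefficients are computed by Goursat's theorem on rectangles in the coordinate
   z = log(k - a), where circles become vertical segments and periodicity cancels the horizontal
   sides. Holomorphic functions are handled as pairs (u, v) of real functions of two variables. *)
Require Import Defs.
From Stdlib Require Import Reals Lra Lia IndefiniteDescription.
From Coquelicot Require Import Coquelicot.
Local Open Scope R_scope.

(** * Nested intervals and repeated bisection of rectangles *)

(** The intervals are nested, so each left endpoint lies below every right endpoint; the supremum of
    the left endpoints is therefore a common point. *)
Lemma nested_intervals_point (a : nat -> R) (w : R)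
  (hw : 0 <= w)
  (ha : forall n, a n <= a (S n) <= a n + w / 2 ^ n / 2) :
  exists x, forall n, a n <= x <= a n + w / 2 ^ n.
Proof.
  assert (h2 : forall n, 0 < 2 ^ n) by (intros n; apply pow_lt; lra).
  assert (hhalf : forall n, w / 2 ^ S n = w / 2 ^ n / 2).
  { intros n; simpl; field; apply Rgt_not_eq, h2. }
  assert (hpos : forall n, 0 <= w / 2 ^ n).
  { intros n; apply Rmult_le_pos; [lra | left; apply Rinv_0_lt_compat, h2]. }
  assert (hshift : forall n k, a n <= a (n + k)%nat
      /\ a (n + k)%nat + w / 2 ^ (n + k) <= a n + w / 2 ^ n).
  { intros n k; induction k as [|k IH].
    - rewrite Nat.add_0_r; lra.
    - rewrite Nat.add_succ_r, hhalf; specialize (ha (n + k)%nat); lra. }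
  assert (hcross : forall m n, a m <= a n + w / 2 ^ n).
  { intros m n; destruct (Nat.le_ge_cases m n) as [h | h].
    - replace n with (m + (n - m))%nat at 1 by lia.
      pose proof (hshift m (n - m)%nat); specialize (hpos n); lra.
    - replace m with (n + (m - n))%nat by lia.
      pose proof (hshift n (m - n)%nat); specialize (hpos (n + (m - n))%nat); lra. }
  destruct (completeness (fun r => exists n, r = a n)) as [x [hub hlub]].
  - exists (a 0%nat + w / 2 ^ 0); intros r [n ->]; apply hcross.
  - exists (a 0%nat), 0%nat; reflexivity.
  - exists x; intros n; split.
    + apply hub; exists n; reflexivity.
    + apply hlub; intros r [m ->]; apply hcross.
Qed.

(** [F] takes a corner and two side lengths. Iterating the choice of a half-size rectangle that
    keeps a quarter of the value loses a factor 4^n in n steps, and the chosen rectangles shrink to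
    a point. *)
Lemma rectangle_bisection (F : R -> R -> R -> R -> R)
  (hF : forall a c w h, 0 <= w -> 0 <= h -> exists a' c',
    a <= a' <= a + w / 2 /\ c <= c' <= c + h / 2 /\
    F a c w h / 4 <= F a' c' (w / 2) (h / 2))
  (a c w h : R) (hw : 0 <= w) (hh : 0 <= h) :
  exists x y, forall n, exists a' c',
    a' <= x <= a' + w / 2 ^ n /\ c' <= y <= c' + h / 2 ^ n /\
    F a c w h / 4 ^ n <= F a' c' (w / 2 ^ n) (h / 2 ^ n).
Proof.
  assert (hpos : forall r n, 0 <= r -> 0 <= r / 2 ^ n).
  { intros r n hr; apply Rmult_le_pos; [lra |].
    left; apply Rinv_0_lt_compat, pow_lt; lra. }
  (* [p] is the corner at level [n] and [q] an admissible corner at the next level; a choice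
     function then yields the whole sequence by recursion. *)
  pose (good := fun (n : nat) (p q : R * R) =>
    fst p <= fst q <= fst p + w / 2 ^ n / 2 /\
    snd p <= snd q <= snd p + h / 2 ^ n / 2 /\
    F (fst p) (snd p) (w / 2 ^ n) (h / 2 ^ n) / 4
      <= F (fst q) (snd q) (w / 2 ^ n / 2) (h / 2 ^ n / 2)).
  assert (hgood : forall n p, exists q, good n p q).
  { intros n p.
    destruct (hF (fst p) (snd p) (w / 2 ^ n) (h / 2 ^ n)) as [a' [c' H]];
      [now apply hpos | now apply hpos |].
    exists (a', c'); exact H. }
  pose (step := fun n p => proj1_sig (constructive_indefinite_description _ (hgood n p))).
  assert (hstep : forall n p, good n p (step n p)).
  { intros n p; unfold step; apply proj2_sig. }
  pose (s := fix s n := match n with O => (a, c) | S m => step m (s m) end).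
  assert (hs : forall n, good n (s n) (s (S n))) by (intros n; apply hstep).
  destruct (nested_intervals_point (fun n => fst (s n)) w hw) as [x hx].
  { intros n; apply (hs n). }
  destruct (nested_intervals_point (fun n => snd (s n)) h hh) as [y hy].
  { intros n; apply (hs n). }
  exists x, y; intros n; exists (fst (s n)), (snd (s n)).
  split; [apply hx | split; [apply hy |]].
  induction n as [|n IH].
  - simpl; rewrite !Rdiv_1_r; lra.
  - destruct (hs n) as [_ [_ H]].
    assert (h2 : 0 < 2 ^ n) by (apply pow_lt; lra).
    assert (h4 : 0 < 4 ^ n) by (apply pow_lt; lra).
    replace (w / 2 ^ S n) with (w / 2 ^ n / 2) by (simpl; field; lra).
    replace (h / 2 ^ S n) with (h / 2 ^ n / 2) by (simpl; field; lra).
    replace (F a c w h / 4 ^ S n) with (F a c w h / 4 ^ n / 4) by (simpl; field; lra).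
    lra.
Qed.

(** * Closed forms, Goursat's theorem, and integrals across a periodic strip *)

(** Closedness of P dx + Q dy is the shared [m], which is both the y-derivative of [P] and the
    x-derivative of [Q]. The partial derivatives are not assumed continuous, hence Goursat's
    argument instead of Green's formula. *)
Definition closed_form (P Q : R -> R -> R) : Prop :=
  forall x y, exists p m q,
    differentiable_pt_lim P x y p m /\ differentiable_pt_lim Q x y m q.

(** The counterclockwise integral of P dx + Q dy along the boundary of [a, b] x [c, d]. *)
Definition circulation (P Q : R -> R -> R) (a b c d : R) : R :=
  RInt (fun x => P x c) a b + RInt (fun y => Q b y) c d
  - RInt (fun x => P x d) a b - RInt (fun y => Q a y) c d.

Lemma differentiable_pt_lim_continuous_l (f : R -> R -> R) (x y p q : R) :
  differentiable_pt_lim f x y p q -> continuous (fun t => f t y) x.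
Proof.
  intros h; apply continuity_pt_filterlim, derivable_continuous_pt.
  exists (p * 1 + q * 0).
  apply (derivable_pt_lim_comp_2d f (fun t => t) (fun _ => y) x p q 1 0 h).
  - apply derivable_pt_lim_id.
  - apply derivable_pt_lim_const.
Qed.

Lemma differentiable_pt_lim_continuous_r (f : R -> R -> R) (x y p q : R) :
  differentiable_pt_lim f x y p q -> continuous (fun t => f x t) y.
Proof.
  intros h; apply continuity_pt_filterlim, derivable_continuous_pt.
  exists (p * 0 + q * 1).
  apply (derivable_pt_lim_comp_2d f (fun _ => x) (fun t => t) y p q 0 1 h).
  - apply derivable_pt_lim_const.
  - apply derivable_pt_lim_id.
Qed.

Section Goursat.
Variables P Q : R -> R -> R.
Hypothesis hPQ : closed_form P Q.

Lemma closed_form_ex_RInt_l (y a b : R) : ex_RInt (fun x => P x y) a b.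
Proof.
  apply (ex_RInt_continuous (V := R_CompleteNormedModule)); intros x _.
  destruct (hPQ x y) as [p [m [q [h _]]]].
  exact (differentiable_pt_lim_continuous_l _ _ _ _ _ h).
Qed.

Lemma closed_form_ex_RInt_r (x c d : R) : ex_RInt (fun y => Q x y) c d.
Proof.
  apply (ex_RInt_continuous (V := R_CompleteNormedModule)); intros y _.
  destruct (hPQ x y) as [p [m [q [_ h]]]].
  exact (differentiable_pt_lim_continuous_r _ _ _ _ _ h).
Qed.

Lemma circulation_Chasles_l (a b e c d : R) :
  circulation P Q a e c d = circulation P Q a b c d + circulation P Q b e c d.
Proof.
  pose proof (fun y => RInt_Chasles (fun x => P x y) a b e
    (closed_form_ex_RInt_l y a b) (closed_form_ex_RInt_l y b e)) as H.
  unfold plus in H; simpl in H.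
  unfold circulation; rewrite <- (H c), <- (H d); ring.
Qed.

Lemma circulation_Chasles_r (a b c d e : R) :
  circulation P Q a b c e = circulation P Q a b c d + circulation P Q a b d e.
Proof.
  pose proof (fun x => RInt_Chasles (fun y => Q x y) c d e
    (closed_form_ex_RInt_r x c d) (closed_form_ex_RInt_r x d e)) as H.
  unfold plus in H; simpl in H.
  unfold circulation; rewrite <- (H a), <- (H b); ring.
Qed.

(** The integrals along the inner sides cancel, so the circulation is the sum over the four
    quarters; by the triangle inequality one of them carries at least a quarter of the absolute
    value. *)
Lemma circulation_bisect (a c w h : R) : 0 <= w -> 0 <= h -> exists a' c',
  a <= a' <= a + w / 2 /\ c <= c' <= c + h / 2 /\
  Rabs (circulation P Q a (a + w) c (c + h)) / 4
    <= Rabs (circulation P Q a' (a' + w / 2) c' (c' + h / 2)).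
Proof.
  intros hw hh.
  pose (J := fun a' c' => circulation P Q a' (a' + w / 2) c' (c' + h / 2)).
  assert (hJ : circulation P Q a (a + w) c (c + h) =
    J a c + J a (c + h / 2) + J (a + w / 2) c + J (a + w / 2) (c + h / 2)).
  { unfold J.
    replace (a + w / 2 + w / 2) with (a + w) by field.
    replace (c + h / 2 + h / 2) with (c + h) by field.
    rewrite (circulation_Chasles_l a (a + w / 2) (a + w)).
    rewrite !(circulation_Chasles_r _ _ c (c + h / 2) (c + h)); ring. }
  rewrite hJ; clear hJ; set (S := J a c + _ + _ + _).
  assert (hS : Rabs S <= Rabs (J a c) + Rabs (J a (c + h / 2))
    + Rabs (J (a + w / 2) c) + Rabs (J (a + w / 2) (c + h / 2))).
  { unfold S.
    do 3 (eapply Rle_trans; [apply Rabs_triang | apply Rplus_le_compat_r]).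
    apply Rle_refl. }
  destruct (Rle_dec (Rabs S / 4) (Rabs (J a c))); [exists a, c; repeat split; try lra; assumption |].
  destruct (Rle_dec (Rabs S / 4) (Rabs (J a (c + h / 2))));
    [exists a, (c + h / 2); repeat split; try lra; assumption |].
  destruct (Rle_dec (Rabs S / 4) (Rabs (J (a + w / 2) c)));
    [exists (a + w / 2), c; repeat split; try lra; assumption |].
  exists (a + w / 2), (c + h / 2); repeat split; try lra.
  fold (J (a + w / 2) (c + h / 2)); lra.
Qed.

(** The first-order part of a closed form at (x, y) has circulation zero, so only the remainder, of
    order [eps * L], is integrated along sides of length at most [L]. *)
Lemma circulation_small (x y eps : R) : 0 < eps -> exists delta, 0 < delta /\
  forall a c w h L, a <= x <= a + w -> c <= y <= c + h ->
  w <= L -> h <= L -> L < delta ->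
  Rabs (circulation P Q a (a + w) c (c + h)) <= eps * L ^ 2.
Proof.
  intros heps.
  destruct (hPQ x y) as [p [m [q [hP hQ]]]].
  assert (he : 0 < eps / 4) by lra.
  destruct (hP (mkposreal _ he)) as [d1 h1].
  destruct (hQ (mkposreal _ he)) as [d2 h2].
  exists (Rmin d1 d2); split; [apply Rmin_pos; apply cond_pos |].
  intros a c w h L hx hy hwL hhL hL.
  pose proof (Rmin_l d1 d2); pose proof (Rmin_r d1 d2).
  assert (hE : forall (f : R -> R -> R) k l (d : posreal),
    (forall u v, Rabs (u - x) < d -> Rabs (v - y) < d ->
      Rabs (f u v - f x y - (k * (u - x) + l * (v - y)))
        <= eps / 4 * Rmax (Rabs (u - x)) (Rabs (v - y))) -> L < d ->
    forall u v, a <= u <= a + w -> c <= v <= c + h ->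
      Rabs (f u v - f x y - (k * (u - x) + l * (v - y))) <= eps / 4 * L).
  { intros f k l d hf hd u v hu hv.
    assert (Rabs (u - x) <= L) by (apply Rabs_le; lra).
    assert (Rabs (v - y) <= L) by (apply Rabs_le; lra).
    eapply Rle_trans; [apply hf; lra |].
    apply Rmult_le_compat_l; [lra | now apply Rmax_lub]. }
  assert (EP := hE P p m d1 h1 ltac:(lra)); assert (EQ := hE Q m q d2 h2 ltac:(lra)).
  clear h1 h2 hE.
  (* Opposite sides are paired: to first order [P] drops by [m * h] from top to bottom and [Q] grows
     by [m * w] from left to right. Two remainders of [eps / 4 * L] give [eps / 2 * L]. *)
  assert (IP : Rabs (RInt (fun u => P u c - P u (c + h) + m * h) a (a + w))
    <= (a + w - a) * (eps / 2 * L)).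
  { apply abs_RInt_le_const; [lra | |].
    - apply (ex_RInt_plus (V := R_NormedModule));
        [apply (ex_RInt_minus (V := R_NormedModule)); apply closed_form_ex_RInt_l
        | apply ex_RInt_const].
    - intros u hu.
      pose proof (EP u c ltac:(lra) ltac:(lra)) as E1.
      pose proof (EP u (c + h) ltac:(lra) ltac:(lra)) as E2.
      apply Rabs_le_between in E1, E2; apply Rabs_le; lra. }
  assert (IQ : Rabs (RInt (fun v => Q (a + w) v - Q a v - m * w) c (c + h))
    <= (c + h - c) * (eps / 2 * L)).
  { apply abs_RInt_le_const; [lra | |].
    - apply (ex_RInt_minus (V := R_NormedModule));
        [apply (ex_RInt_minus (V := R_NormedModule)); apply closed_form_ex_RInt_r
        | apply ex_RInt_const].
    - intros v hv.
      pose proof (EQ a v ltac:(lra) ltac:(lra)) as E1.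
      pose proof (EQ (a + w) v ltac:(lra) ltac:(lra)) as E2.
      apply Rabs_le_between in E1, E2; apply Rabs_le; lra. }
  assert (RP : RInt (fun u => P u c - P u (c + h) + m * h) a (a + w) =
    RInt (fun u => P u c) a (a + w) - RInt (fun u => P u (c + h)) a (a + w) + w * (m * h)).
  { rewrite (RInt_plus (V := R_CompleteNormedModule) (fun u => P u c - P u (c + h))).
    - rewrite (RInt_minus (V := R_CompleteNormedModule)); try apply closed_form_ex_RInt_l.
      rewrite RInt_const; unfold plus, minus, opp, scal; simpl; unfold plus, mult; simpl; ring.
    - apply (ex_RInt_minus (V := R_NormedModule)); apply closed_form_ex_RInt_l.
    - apply ex_RInt_const. }
  assert (RQ : RInt (fun v => Q (a + w) v - Q a v - m * w) c (c + h) =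
    RInt (fun v => Q (a + w) v) c (c + h) - RInt (fun v => Q a v) c (c + h) - h * (m * w)).
  { rewrite (RInt_minus (V := R_CompleteNormedModule) (fun v => Q (a + w) v - Q a v)).
    - rewrite (RInt_minus (V := R_CompleteNormedModule)); try apply closed_form_ex_RInt_r.
      rewrite RInt_const; unfold plus, minus, opp, scal; simpl; unfold plus, opp, mult; simpl. 
      change (fun v => Q (a + w) v) with (Q (a + w)); change (fun v => Q a v) with (Q a); ring.
    - apply (ex_RInt_minus (V := R_NormedModule)); apply closed_form_ex_RInt_r.
    - apply ex_RInt_const. }
  rewrite RP in IP; rewrite RQ in IQ.
  (* The corrections [w * (m * h)] and [h * (m * w)] cancel; this is where closedness enters. *)
  replace (circulation P Q a (a + w) c (c + h)) with
    ((RInt (fun u => P u c) a (a + w) - RInt (fun u => P u (c + h)) a (a + w) + w * (m * h))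
    + (RInt (fun v => Q (a + w) v) c (c + h) - RInt (fun v => Q a v) c (c + h) - h * (m * w)))
    by (unfold circulation; ring).
  eapply Rle_trans; [apply Rabs_triang |].
  assert (0 <= eps / 2 * L) by (apply Rmult_le_pos; lra).
  assert ((a + w - a) * (eps / 2 * L) <= L * (eps / 2 * L))
    by (apply Rmult_le_compat_r; lra).
  assert ((c + h - c) * (eps / 2 * L) <= L * (eps / 2 * L))
    by (apply Rmult_le_compat_r; lra).
  replace (eps * L ^ 2) with (L * (eps / 2 * L) + L * (eps / 2 * L)) by field.
  lra.
Qed.

(** Bisection gives rectangles around a point (x, y) with circulation at least K / 4^n, while
    differentiability at that point bounds it by an arbitrarily small multiple of the squared size,
    also of order 1 / 4^n. *)
Lemma circulation_eq_0 (a b c d : R) :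
  a <= b -> c <= d -> circulation P Q a b c d = 0.
Proof.
  intros hab hcd.
  destruct (rectangle_bisection
    (fun a c w h => Rabs (circulation P Q a (a + w) c (c + h))) circulation_bisect
    a c (b - a) (d - c) ltac:(lra) ltac:(lra)) as [x [y hn]].
  replace (a + (b - a)) with b in hn by ring.
  replace (c + (d - c)) with d in hn by ring.
  set (K := Rabs (circulation P Q a b c d)) in hn.
  assert (hK : K <= 0).
  2:{ unfold K in hK; pose proof (Rabs_pos (circulation P Q a b c d)).
      apply Rabs_eq_0; lra. }
  apply le_epsilon; intros eps heps; rewrite Rplus_0_l.
  (* [L] dominates both sides, and the added 1 keeps it positive for a degenerate rectangle. The
     tolerance [eps / L ^ 2] below makes the final bound [eps / 4 ^ N]. *)
  pose (L := b - a + (d - c) + 1).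
  assert (hL : 0 < L) by (unfold L; lra).
  destruct (circulation_small x y (eps / L ^ 2)) as [delta [hd hsmall]].
  { apply Rdiv_lt_0_compat; [lra | apply pow_lt, hL]. }
  destruct (is_lim_seq_geom (/ 2) ltac:(rewrite Rabs_pos_eq; lra)
    (fun t => Rabs t < delta / L)) as [N hN].
  { exists (mkposreal (delta / L) ltac:(apply Rdiv_lt_0_compat; lra)).
    intros t ht; unfold ball in ht; simpl in ht; unfold AbsRing_ball, abs, minus, plus, opp in ht.
    simpl in ht; rewrite Ropp_0, Rplus_0_r in ht; exact ht. }
  specialize (hN N (Nat.le_refl N)).
  assert (h2 : 0 < 2 ^ N) by (apply pow_lt; lra).
  rewrite pow_inv in hN; rewrite Rabs_pos_eq in hN
    by (left; now apply Rinv_0_lt_compat).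
  destruct (hn N) as [a' [c' [hx [hy H]]]].
  specialize (hsmall a' c' ((b - a) / 2 ^ N) ((d - c) / 2 ^ N) (L / 2 ^ N) hx hy).
  assert (hK' : K / 4 ^ N <= eps / L ^ 2 * (L / 2 ^ N) ^ 2).
  { eapply Rle_trans; [exact H |]; apply hsmall.
    - apply Rmult_le_compat_r; [left; now apply Rinv_0_lt_compat | unfold L; lra].
    - apply Rmult_le_compat_r; [left; now apply Rinv_0_lt_compat | unfold L; lra].
    - apply (Rmult_lt_compat_l L) in hN; [| assumption].
      replace (L * (delta / L)) with delta in hN by (field; lra); exact hN. }
  assert (h4 : 4 ^ N = 2 ^ N * 2 ^ N) by (rewrite <- Rpow_mult_distr; f_equal; lra).
  replace (eps / L ^ 2 * (L / 2 ^ N) ^ 2) with (eps / 4 ^ N) in hK'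
    by (rewrite h4; field; lra).
  apply (Rmult_le_compat_r (4 ^ N)) in hK'; [| rewrite h4; nra].
  assert (4 ^ N <> 0) by (rewrite h4; nra).
  unfold Rdiv in hK'; rewrite !Rmult_assoc, Rinv_l, !Rmult_1_r in hK' by assumption.
  exact hK'.
Qed.

(** In the vanishing circulation around [a, b] x [0, T] the two horizontal sides cancel by
    periodicity, leaving the difference of the vertical ones. *)
Lemma strip_integral_const (T a b : R) (hT : 0 <= T) (hper : forall x, P x T = P x 0) :
  RInt (fun y => Q a y) 0 T = RInt (fun y => Q b y) 0 T.
Proof.
  assert (H : forall a b, a <= b ->
    RInt (fun y => Q a y) 0 T = RInt (fun y => Q b y) 0 T).
  { clear a b; intros a b hab; pose proof (circulation_eq_0 a b 0 T hab hT) as h.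
    unfold circulation in h.
    rewrite (RInt_ext (fun x => P x T) (fun x => P x 0)) in h by (intros; apply hper).
    lra. }
  destruct (Rle_dec a b); [now apply H | symmetry; apply H; lra].
Qed.

Lemma strip_integral_eq_0 (T : R) (hT : 0 <= T) (hper : forall x, P x T = P x 0)
  (hlim : forall eps, 0 < eps -> exists s, forall t, Rabs (Q s t) <= eps) (s : R) :
  RInt (fun y => Q s y) 0 T = 0.
Proof.
  assert (h0 : Rabs (RInt (fun y => Q s y) 0 T) <= 0).
  2:{ pose proof (Rabs_pos (RInt (fun y => Q s y) 0 T)); apply Rabs_eq_0; lra. }
  apply le_epsilon; intros eps heps; rewrite Rplus_0_l.
  (* The integral may be moved to a line where [Q] is uniformly small; [T + 1] avoids dividing by
     zero when [T] is 0. *)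
  destruct (hlim (eps / (T + 1))) as [s' hs']; [apply Rdiv_lt_0_compat; lra |].
  rewrite (strip_integral_const T s s' hT hper).
  eapply Rle_trans.
  { apply abs_RInt_le_const; [exact hT | apply closed_form_ex_RInt_r | intros t _; apply hs']. }
  rewrite Rminus_0_r.
  apply (Rmult_le_reg_r (T + 1)); [lra |].
  replace (T * (eps / (T + 1)) * (T + 1)) with (T * eps) by (field; lra); nra.
Qed.

End Goursat.

(** * Differentiation rules for functions of two variables and for holomorphic pairs *)

Lemma differentiable_pt_lim_const (c x y : R) :
  differentiable_pt_lim (fun _ _ => c) x y 0 0.
Proof.
  apply (differentiable_pt_lim_proj1_0 (fun _ => c)), derivable_pt_lim_const.
Qed.

Lemma differentiable_pt_lim_plus (f g : R -> R -> R) (x y p q p' q' : R) :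
  differentiable_pt_lim f x y p q -> differentiable_pt_lim g x y p' q' ->
  differentiable_pt_lim (fun s t => f s t + g s t) x y (p + p') (q + q').
Proof.
  intros hf hg.
  replace (p + p') with (1 * p + 1 * p') by ring.
  replace (q + q') with (1 * q + 1 * q') by ring.
  apply (differentiable_pt_lim_comp (fun u v => u + v)); [| exact hf | exact hg].
  intros eps; exists (mkposreal 1 Rlt_0_1); intros u v _ _.
  replace (u + v - _ - _) with 0 by ring; rewrite Rabs_R0.
  apply Rmult_le_pos; [left; apply cond_pos |].
  eapply Rle_trans; [apply Rabs_pos | apply Rmax_l].
Qed.

Lemma differentiable_pt_lim_mult (f g : R -> R -> R) (x y p q p' q' : R) :
  differentiable_pt_lim f x y p q -> differentiable_pt_lim g x y p' q' ->
  differentiable_pt_lim (fun s t => f s t * g s t) x y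
    (g x y * p + f x y * p') (g x y * q + f x y * q').
Proof.
  intros hf hg.
  apply (differentiable_pt_lim_comp (fun u v => u * v)); [| exact hf | exact hg].
  set (a := f x y); set (b := g x y).
  (* The remainder of the product is exactly (u - a)(v - b), so [eps] itself serves as [delta]. *)
  intros eps; exists eps; intros u v hu _.
  replace (u * v - a * b - _) with ((u - a) * (v - b)) by ring.
  rewrite Rabs_mult; apply Rmult_le_compat; try apply Rabs_pos; [lra | apply Rmax_r].
Qed.

Lemma differentiable_pt_lim_separate (f g : R -> R) (x y p q : R) :
  derivable_pt_lim f x p -> derivable_pt_lim g y q ->
  differentiable_pt_lim (fun s t => f s * g t) x y (p * g y) (f x * q).
Proof.
  intros hf hg.
  replace (p * g y) with (p * g y + q * 0) by ring.
  replace (f x * q) with (p * 0 + f x * q) by ring.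
  assert (h : differentiable_pt_lim (fun _ t => g t) x y 0 q).
  (* The rule for a function of the first variable is applied with the two variables exchanged. *)
  { intros eps; destruct (differentiable_pt_lim_proj1_0 g y x q hg eps) as [d hd].
    exists d; intros u v hu hv; specialize (hd v u hv hu).
    rewrite Rmax_comm.
    replace (0 * (u - x) + q * (v - y)) with (q * (v - y) + 0 * (u - x)) by ring.
    exact hd. }
  pose proof (differentiable_pt_lim_mult (fun s _ => f s) (fun _ t => g t) x y p 0 0 q
    (differentiable_pt_lim_proj1_0 f x y p hf) h) as H.
  replace (p * g y + q * 0) with (g y * p + f x * 0) by ring.
  replace (p * 0 + f x * q) with (g y * 0 + f x * q) by ring.
  exact H.
Qed.

(* [u + i v] has complex derivative [p + i q] at [x + i y]. *)
Definition holo_pt (u v : R -> R -> R) (x y p q : R) : Prop :=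
  differentiable_pt_lim u x y p (- q) /\ differentiable_pt_lim v x y q p.

Lemma holo_pt_plus (u v u' v' : R -> R -> R) (x y p q p' q' : R) :
  holo_pt u v x y p q -> holo_pt u' v' x y p' q' ->
  holo_pt (fun s t => u s t + u' s t) (fun s t => v s t + v' s t) x y (p + p') (q + q').
Proof.
  intros [h1 h2] [h3 h4]; split; [rewrite Ropp_plus_distr |];
    now apply differentiable_pt_lim_plus.
Qed.

Lemma holo_pt_const (c d x y : R) : holo_pt (fun _ _ => c) (fun _ _ => d) x y 0 0.
Proof. split; [rewrite Ropp_0 |]; apply differentiable_pt_lim_const. Qed.

(** The real part is written with [+ - 1 *] so that the sum and product rules apply to it
    literally. *)
Lemma holo_pt_mult (u v u' v' : R -> R -> R) (x y p q p' q' : R) :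
  holo_pt u v x y p q -> holo_pt u' v' x y p' q' ->
  holo_pt (fun s t => u s t * u' s t + - 1 * (v s t * v' s t))
    (fun s t => u s t * v' s t + v s t * u' s t) x y
    (u x y * p' - v x y * q' + p * u' x y - q * v' x y)
    (u x y * q' + v x y * p' + p * v' x y + q * u' x y).
Proof.
  intros [h1 h2] [h3 h4]; split.
  - pose proof (differentiable_pt_lim_plus _ _ _ _ _ _ _ _
      (differentiable_pt_lim_mult _ _ _ _ _ _ _ _ h1 h3)
      (differentiable_pt_lim_mult _ _ _ _ _ _ _ _ (differentiable_pt_lim_const (- 1) x y)
        (differentiable_pt_lim_mult _ _ _ _ _ _ _ _ h2 h4))) as H.
    match type of H with differentiable_pt_lim _ _ _ ?k ?l =>
      match goal with |- differentiable_pt_lim _ _ _ ?k' ?l' =>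
        replace k' with k by ring; replace l' with l by ring end end.
    exact H.
  - pose proof (differentiable_pt_lim_plus _ _ _ _ _ _ _ _
      (differentiable_pt_lim_mult _ _ _ _ _ _ _ _ h1 h4)
      (differentiable_pt_lim_mult _ _ _ _ _ _ _ _ h2 h3)) as H.
    match type of H with differentiable_pt_lim _ _ _ ?k ?l =>
      match goal with |- differentiable_pt_lim _ _ _ ?k' ?l' =>
        replace k' with k by ring; replace l' with l by ring end end.
    exact H.
Qed.

Lemma holo_pt_comp (u v h k : R -> R -> R) (x y p q p' q' : R) :
  holo_pt u v (h x y) (k x y) p q -> holo_pt h k x y p' q' ->
  holo_pt (fun s t => u (h s t) (k s t)) (fun s t => v (h s t) (k s t)) x y
    (p * p' - q * q') (p * q' + q * p').
Proof.
  intros [h1 h2] [h3 h4]; split.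
  - pose proof (differentiable_pt_lim_comp _ _ _ _ _ _ _ _ _ _ _ h1 h3 h4) as H.
    replace (p * p' - q * q') with (p * p' + - q * q') by ring.
    replace (- (p * q' + q * p')) with (p * - q' + - q * p') by ring.
    exact H.
  - pose proof (differentiable_pt_lim_comp _ _ _ _ _ _ _ _ _ _ _ h2 h3 h4) as H.
    replace (p * q' + q * p') with (q * p' + p * q') by ring.
    replace (p * p' - q * q') with (q * - q' + p * p') by ring.
    exact H.
Qed.

(** This is e^(kz): [k = 1] parametrises the punctured plane by vertical lines over circles, and
    other values of [k] give the Fourier weights. *)
Lemma holo_pt_exp (k x y : R) :
  holo_pt (fun s t => exp (k * s) * cos (k * t)) (fun s t => exp (k * s) * sin (k * t)) x y
    (k * (exp (k * x) * cos (k * y))) (k * (exp (k * x) * sin (k * y))).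
Proof.
  assert (he : derivable_pt_lim (fun s => exp (k * s)) x (k * exp (k * x)))
    by (apply is_derive_Reals; auto_derive; [trivial | ring]).
  split.
  - pose proof (differentiable_pt_lim_separate _ (fun t => cos (k * t)) x y _
      (- (k * sin (k * y))) he ltac:(apply is_derive_Reals; auto_derive; [trivial | ring])) as H.
    match type of H with differentiable_pt_lim _ _ _ ?k ?l =>
      match goal with |- differentiable_pt_lim _ _ _ ?k' ?l' =>
        replace k' with k by ring; replace l' with l by ring end end.
    exact H.
  - pose proof (differentiable_pt_lim_separate _ (fun t => sin (k * t)) x y _
      (k * cos (k * y)) he ltac:(apply is_derive_Reals; auto_derive; [trivial | ring])) as H.
    match type of H with differentiable_pt_lim _ _ _ ?k ?l =>
      match goal with |- differentiable_pt_lim _ _ _ ?k' ?l' =>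
        replace k' with k by ring; replace l' with l by ring end end.
    exact H.
Qed.

(** The mean value theorem along the segment from (a, b) to (a + h, b + k). *)
Lemma differentiable_pt_lim_bound (w : R -> R -> R) (dx dy : R -> R -> R) (L : R)
  (hw : forall x y, differentiable_pt_lim w x y (dx x y) (dy x y))
  (hx : forall x y, Rabs (dx x y) <= L) (hy : forall x y, Rabs (dy x y) <= L)
  (a b h k : R) : Rabs (w (a + h) (b + k) - w a b) <= L * (Rabs h + Rabs k).
Proof.
  destruct (MVT_abs (fun t => w (a + t * h) (b + t * k))
    (fun t => dx (a + t * h) (b + t * k) * h + dy (a + t * h) (b + t * k) * k) 0 1)
    as [c [hc _]].
  - intros t _.
    apply (derivable_pt_lim_comp_2d w (fun t => a + t * h) (fun t => b + t * k));
      [apply hw | |]; apply is_derive_Reals; auto_derive; trivial; ring.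
  - rewrite Rmult_0_l, Rmult_1_l, Rminus_0_r, Rabs_R1, Rmult_1_r in hc.
    rewrite !Rmult_1_l, Rmult_0_l, !Rplus_0_r in hc.
    rewrite hc; eapply Rle_trans; [apply Rabs_triang |].
    rewrite !Rabs_mult, Rmult_plus_distr_l.
    apply Rplus_le_compat; apply Rmult_le_compat_r; auto using Rabs_pos.
Qed.

(** * Fourier integrals over circles *)

(* The integrals along [z = ln r + i t] of the real and imaginary parts of
   [g (c + e^z) e^(k z)], with [g = u + i v] and [c = a + i b]: since [g (c + h) = o(h)] and
   [k >= -1], the integrand tends to 0 as [Re z] tends to minus infinity. *)
Lemma circle_integral_eq_0 (u v : R -> R -> R) (a b : R)
  (hol : forall x y, exists p q, holo_pt u v x y p q)
  (hu0 : u a b = 0) (hv0 : v a b = 0) (h0 : holo_pt u v a b 0 0)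
  (k : R) (hk : - 1 <= k) (hcos : cos (k * (2 * PI)) = 1) (hsin : sin (k * (2 * PI)) = 0)
  (r : R) (hr : 0 < r) :
  RInt (fun t => u (a + r * cos t) (b + r * sin t) * cos (k * t)
    - v (a + r * cos t) (b + r * sin t) * sin (k * t)) 0 (2 * PI) = 0 /\
  RInt (fun t => u (a + r * cos t) (b + r * sin t) * sin (k * t)
    + v (a + r * cos t) (b + r * sin t) * cos (k * t)) 0 (2 * PI) = 0.
Proof.
  (* X + iY is c + e^z, C + iS is e^(kz), and A + iB is the integrand. The factors 1 make [X] and
     [Y] instances of [holo_pt_exp]. *)
  pose (X := fun s t => a + exp (1 * s) * cos (1 * t)).
  pose (Y := fun s t => b + exp (1 * s) * sin (1 * t)).
  pose (C := fun s t => exp (k * s) * cos (k * t)).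
  pose (S := fun s t => exp (k * s) * sin (k * t)).
  pose (A := fun s t => u (X s t) (Y s t) * C s t + - 1 * (v (X s t) (Y s t) * S s t)).
  pose (B := fun s t => u (X s t) (Y s t) * S s t + v (X s t) (Y s t) * C s t).
  assert (hAB : forall s t, exists p q, holo_pt A B s t p q).
  { intros s t; destruct (hol (X s t) (Y s t)) as [p [q h]].
    eexists; eexists; apply (holo_pt_mult _ _ C S); [| apply holo_pt_exp].
    apply (holo_pt_comp u v X Y); [exact h |].
    apply (holo_pt_plus (fun _ _ => a) (fun _ _ => b)); [apply holo_pt_const | apply holo_pt_exp]. }
  assert (hsmall : forall eps, 0 < eps -> exists s, forall t,
    Rabs (A s t) <= eps /\ Rabs (B s t) <= eps).
  { intros eps heps; destruct h0 as [h1 h2].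
    assert (he : 0 < eps / 2) by lra.
    destruct (h1 (mkposreal _ he)) as [d1 H1]; destruct (h2 (mkposreal _ he)) as [d2 H2].
    (* A radius within both neighbourhoods and below 1, so that [ln m] is negative. *)
    pose (m := Rmin (Rmin d1 d2) 1 / 2).
    assert (hm : 0 < m /\ m < d1 /\ m < d2 /\ m < 1).
    { pose proof (cond_pos d1); pose proof (cond_pos d2).
      unfold m; pose proof (Rmin_l (Rmin d1 d2) 1); pose proof (Rmin_r (Rmin d1 d2) 1);
      pose proof (Rmin_l d1 d2); pose proof (Rmin_r d1 d2).
      assert (0 < Rmin (Rmin d1 d2) 1) by (repeat apply Rmin_pos; lra); lra. }
    exists (ln m); intros t.
    assert (hX : Rabs (X (ln m) t - a) <= m).
    { unfold X; replace (a + exp (1 * ln m) * cos (1 * t) - a) with (m * cos t).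
      - pose proof (COS_bound t); apply Rabs_le; nra.
      - rewrite !Rmult_1_l, exp_ln by lra; ring. }
    assert (hY : Rabs (Y (ln m) t - b) <= m).
    { unfold Y; replace (b + exp (1 * ln m) * sin (1 * t) - b) with (m * sin t).
      - pose proof (SIN_bound t); apply Rabs_le; nra.
      - rewrite !Rmult_1_l, exp_ln by lra; ring. }
    specialize (H1 (X (ln m) t) (Y (ln m) t) ltac:(lra) ltac:(lra)).
    specialize (H2 (X (ln m) t) (Y (ln m) t) ltac:(lra) ltac:(lra)).
    rewrite hu0 in H1; rewrite hv0 in H2; simpl in H1, H2.
    pose proof (Rmax_lub _ _ _ hX hY) as hmax.
    assert (hu : Rabs (u (X (ln m) t) (Y (ln m) t)) <= eps / 2 * m).
    { eapply Rle_trans; [| apply Rmult_le_compat_l; [lra | exact hmax]].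
      eapply Rle_trans; [right | exact H1]; f_equal; ring. }
    assert (hv : Rabs (v (X (ln m) t) (Y (ln m) t)) <= eps / 2 * m).
    { eapply Rle_trans; [| apply Rmult_le_compat_l; [lra | exact hmax]].
      eapply Rle_trans; [right | exact H2]; f_equal; ring. }
    (* The product is m^(k + 1), with k + 1 nonnegative and m below 1. *)
    assert (hE : m * exp (k * ln m) <= 1).
    { rewrite <- (exp_ln m) at 1 by lra.
      rewrite <- exp_plus, <- exp_0.
      assert (ln m < 0) by (rewrite <- ln_1; apply ln_increasing; lra).
      assert (hle : ln m + k * ln m <= 0) by nra.
      destruct hle as [hlt | ->]; [left; now apply exp_increasing | right; reflexivity]. }
    pose proof (exp_pos (k * ln m)) as hEp.
    assert (hprod : forall z c, Rabs z <= eps / 2 * m -> - 1 <= c <= 1 ->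
      Rabs (z * (exp (k * ln m) * c)) <= eps / 2).
    { intros z c hz hc; rewrite !Rabs_mult, (Rabs_pos_eq (exp _)) by lra.
      assert (hc' : Rabs c <= 1) by (apply Rabs_le; lra).
      apply Rle_trans with (eps / 2 * m * (exp (k * ln m) * 1)).
      - apply Rmult_le_compat; [apply Rabs_pos | apply Rmult_le_pos; [lra | apply Rabs_pos]
          | exact hz | apply Rmult_le_compat_l; lra].
      - nra. }
    unfold A, B, C, S.
    pose proof (hprod _ _ hu (COS_bound (k * t))) as e1.
    pose proof (hprod _ _ hu (SIN_bound (k * t))) as e2.
    pose proof (hprod _ _ hv (COS_bound (k * t))) as e3.
    pose proof (hprod _ _ hv (SIN_bound (k * t))) as e4.
    apply Rabs_le_between in e1, e2, e3, e4.
    split; apply Rabs_le; lra. }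
  assert (hper : forall s, X s (2 * PI) = X s 0 /\ Y s (2 * PI) = Y s 0 /\
    C s (2 * PI) = C s 0 /\ S s (2 * PI) = S s 0).
  { intros s; unfold X, Y, C, S.
    rewrite hcos, hsin, !Rmult_0_r, !Rmult_1_l, cos_0, sin_0, cos_2PI, sin_2PI.
    repeat split; ring. }
  pose proof PI_RGT_0 as hPI.
  (* With z = s + it, the imaginary part of (A + iB) dz is B ds + A dt and minus its real part is -A
     ds + B dt; both are closed by the Cauchy-Riemann equations. *)
  assert (IA : RInt (fun t => A (ln r) t) 0 (2 * PI) = 0).
  { apply (strip_integral_eq_0 B A); [| lra | |].
    - intros s t; destruct (hAB s t) as [p [q [h1 h2]]].
      exists q, p, (- q); split; assumption.
    - intros s; destruct (hper s) as [e1 [e2 [e3 e4]]]; unfold B; now rewrite e1, e2, e3, e4.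
    - intros eps heps; destruct (hsmall eps heps) as [s hs]; exists s; intros t; apply hs. }
  assert (IB : RInt (fun t => B (ln r) t) 0 (2 * PI) = 0).
  { apply (strip_integral_eq_0 (fun s t => - 1 * A s t) B); [| lra | |].
    - intros s t; destruct (hAB s t) as [p [q [h1 h2]]].
      exists (A s t * 0 + - 1 * p), q, p; split; [| assumption].
      pose proof (differentiable_pt_lim_mult _ _ _ _ _ _ _ _
        (differentiable_pt_lim_const (- 1) s t) h1) as H.
      cbv beta in H; replace (A s t * 0 + - 1 * - q) with q in H by ring; exact H.
    - intros s; destruct (hper s) as [e1 [e2 [e3 e4]]]; unfold A; now rewrite e1, e2, e3, e4.
    - intros eps heps; destruct (hsmall eps heps) as [s hs]; exists s; intros t; apply hs. }
  pose proof (exp_pos (k * ln r)) as hE.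
  assert (hex : forall s, ex_RInt (fun t => A s t) 0 (2 * PI) /\ ex_RInt (fun t => B s t) 0 (2 * PI)).
  { intros s; split; apply (ex_RInt_continuous (V := R_CompleteNormedModule)); intros t _;
      destruct (hAB s t) as [p [q [h1 h2]]]; eapply differentiable_pt_lim_continuous_r; eassumption. }
  destruct (hex (ln r)) as [exA exB].
  split.
  (* On the line s = ln r the weight carries the constant factor r^k, which is divided out. *)
  - rewrite (RInt_ext _ (fun t => scal (/ exp (k * ln r)) (A (ln r) t))).
    + rewrite (RInt_scal (V := R_CompleteNormedModule) (fun t => A (ln r) t)), IA by exact exA.
      unfold scal; simpl; unfold mult; simpl; ring.
    + intros t _; unfold A, X, Y, C, S, scal; simpl; unfold mult; simpl.
      rewrite !Rmult_1_l, exp_ln by lra; field; lra.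
  - rewrite (RInt_ext _ (fun t => scal (/ exp (k * ln r)) (B (ln r) t))).
    + rewrite (RInt_scal (V := R_CompleteNormedModule) (fun t => B (ln r) t)), IB by exact exB.
      unfold scal; simpl; unfold mult; simpl; ring.
    + intros t _; unfold B, X, Y, C, S, scal; simpl; unfold mult; simpl.
      rewrite !Rmult_1_l, exp_ln by lra; field; lra.
Qed.

Lemma holo_pt_affine (c d p q x y : R) :
  holo_pt (fun s t => c + p * s - q * t) (fun s t => d + q * s + p * t) x y p q.
Proof.
  assert (hz : forall (eps : posreal) z s t, z = 0 -> Rabs z <= eps * Rmax (Rabs s) (Rabs t)).
  { intros eps z s t ->; rewrite Rabs_R0.
    apply Rmult_le_pos; [left; apply cond_pos |].
    eapply Rle_trans; [apply Rabs_pos | apply Rmax_l]. }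
  split; intros eps; exists (mkposreal 1 Rlt_0_1); intros s t _ _; apply hz; ring.
Qed.

(* After subtraction of the first-order Taylor polynomial, the cases [k = 1] and [k = -1] of
   [circle_integral_eq_0] are combined so that [u] cancels. *)
Lemma circle_integrals_of_im (u v : R -> R -> R) (a b p q : R)
  (hol : forall x y, exists p q, holo_pt u v x y p q) (h0 : holo_pt u v a b p q)
  (r : R) (hr : 0 < r) :
  is_RInt (fun t => v (a + r * cos t) (b + r * sin t)) 0 (2 * PI) (2 * PI * v a b) /\
  is_RInt (fun t => v (a + r * cos t) (b + r * sin t) * cos t) 0 (2 * PI) (PI * r * q) /\
  is_RInt (fun t => v (a + r * cos t) (b + r * sin t) * sin t) 0 (2 * PI) (PI * r * p).
Proof.
  (* The Taylor polynomial is subtracted by adding an affine pair with coefficients [- p] and [- q],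
     in the shape of [holo_pt_affine]. *)
  pose (U := fun x y => u x y + (- u a b + p * a - q * b + - p * x - - q * y)).
  pose (V := fun x y => v x y + (- v a b + q * a + p * b + - q * x + - p * y)).
  assert (hUV : forall x y, exists p q, holo_pt U V x y p q).
  { intros x y; destruct (hol x y) as [p' [q' h]].
    exists (p' + - p), (q' + - q); apply holo_pt_plus; [exact h | apply holo_pt_affine]. }
  assert (h0' : holo_pt U V a b 0 0).
  { replace 0 with (p + - p) at 1 by ring; replace 0 with (q + - q) by ring.
    apply holo_pt_plus; [exact h0 | apply holo_pt_affine]. }
  assert (hU0 : U a b = 0) by (unfold U; ring).
  assert (hV0 : V a b = 0) by (unfold V; ring).
  pose (X := fun t => a + r * cos t); pose (Y := fun t => b + r * sin t).
  assert (hc : forall k t, continuous (fun t => U (X t) (Y t) * cos (k * t) - V (X t) (Y t) * sin (k * t)) t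
    /\ continuous (fun t => U (X t) (Y t) * sin (k * t) + V (X t) (Y t) * cos (k * t)) t).
  { intros k t; destruct (hUV (X t) (Y t)) as [p' [q' [h1 h2]]].
    assert (hX : derivable_pt_lim X t (- r * sin t))
      by (apply is_derive_Reals; unfold X; auto_derive; [trivial | ring]).
    assert (hY : derivable_pt_lim Y t (r * cos t))
      by (apply is_derive_Reals; unfold Y; auto_derive; [trivial | ring]).
    assert (dU : ex_derive (fun t => U (X t) (Y t)) t).
    { eexists; apply is_derive_Reals; exact (derivable_pt_lim_comp_2d U X Y t _ _ _ _ h1 hX hY). }
    assert (dV : ex_derive (fun t => V (X t) (Y t)) t).
    { eexists; apply is_derive_Reals; exact (derivable_pt_lim_comp_2d V X Y t _ _ _ _ h2 hX hY). }
    split; apply (ex_derive_continuous (K := R_AbsRing) (V := R_NormedModule)).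
    - apply (ex_derive_minus (K := R_AbsRing) (V := R_NormedModule));
        apply ex_derive_mult; try assumption; auto_derive; trivial.
    - apply (ex_derive_plus (K := R_AbsRing) (V := R_NormedModule));
        apply ex_derive_mult; try assumption; auto_derive; trivial. }
  assert (hI : forall k, - 1 <= k -> cos (k * (2 * PI)) = 1 -> sin (k * (2 * PI)) = 0 ->
    is_RInt (fun t => U (X t) (Y t) * cos (k * t) - V (X t) (Y t) * sin (k * t)) 0 (2 * PI) 0 /\
    is_RInt (fun t => U (X t) (Y t) * sin (k * t) + V (X t) (Y t) * cos (k * t)) 0 (2 * PI) 0).
  { intros k hk hcos hsin.
    destruct (circle_integral_eq_0 U V a b hUV hU0 hV0 h0' k hk hcos hsin r hr) as [e1 e2].
    assert (hR : forall f l, ex_RInt f 0 (2 * PI) -> RInt f 0 (2 * PI) = l ->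
      is_RInt f 0 (2 * PI) l)
      by (intros f l h <-; apply (RInt_correct (V := R_CompleteNormedModule)), h).
    split; [apply hR; [| exact e1] | apply hR; [| exact e2]];
      apply (ex_RInt_continuous (V := R_CompleteNormedModule)); intros t _;
      [apply (proj1 (hc k t)) | apply (proj2 (hc k t))]. }
  destruct (hI 0) as [_ I0]; [lra | rewrite Rmult_0_l; apply cos_0 | rewrite Rmult_0_l; apply sin_0 |].
  destruct (hI 1) as [I1 I1']; [lra | rewrite Rmult_1_l; apply cos_2PI | rewrite Rmult_1_l; apply sin_2PI |].
  destruct (hI (- 1)) as [I2 I2']; [lra | | |].
  { replace (- 1 * (2 * PI)) with (- (2 * PI)) by ring; rewrite cos_neg; apply cos_2PI. }
  { replace (- 1 * (2 * PI)) with (- (2 * PI)) by ring; rewrite sin_neg, sin_2PI; ring. }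
  clear hI hc.
  assert (hprim : forall f f' : R -> R, (forall t, is_derive f t (f' t)) ->
    (forall t, ex_derive f' t) -> is_RInt f' 0 (2 * PI) (f (2 * PI) - f 0)).
  { intros f f' h1 h2; apply (is_RInt_derive (V := R_CompleteNormedModule)); intros t _;
      [apply h1 | apply (ex_derive_continuous (K := R_AbsRing) (V := R_NormedModule)), h2]. }
  set (v0 := v a b) in *.
  (* On the circle the Taylor polynomial of [v] is v0 + r (q cos t + p sin t). Its integrals against
     1, cos and sin come from explicit primitives and supply the stated values. *)
  assert (J0 := hprim (fun t => v0 * t + r * q * sin t - r * p * cos t)
    (fun t => v0 + r * (q * cos t + p * sin t))
    ltac:(intros t; auto_derive; [trivial | ring]) ltac:(intros t; auto_derive; trivial)).
  assert (J1 := hprim (fun t => v0 * sin t + r * q * ((t + sin t * cos t) / 2) + r * p * (sin t * sin t / 2))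
    (fun t => (v0 + r * (q * cos t + p * sin t)) * cos t)
    ltac:(intros t; auto_derive; [trivial | pose proof (sin2_cos2 t) as e; unfold Rsqr in e;
      apply Rminus_diag_uniq;
      transitivity (r * q / 2 * (1 - (sin t * sin t + cos t * cos t))); [field | rewrite e; ring]])
    ltac:(intros t; auto_derive; trivial)).
  assert (J2 := hprim (fun t => - v0 * cos t + r * q * (sin t * sin t / 2) + r * p * ((t - sin t * cos t) / 2))
    (fun t => (v0 + r * (q * cos t + p * sin t)) * sin t)
    ltac:(intros t; auto_derive; [trivial | pose proof (sin2_cos2 t) as e; unfold Rsqr in e;
      apply Rminus_diag_uniq;
      transitivity (r * p / 2 * (1 - (sin t * sin t + cos t * cos t))); [field | rewrite e; ring]])
    ltac:(intros t; auto_derive; trivial)).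
  cbv beta in J0, J1, J2; rewrite sin_0, cos_0, sin_2PI, cos_2PI in J0, J1, J2.
  split; [| split].
  - pose proof (is_RInt_plus _ _ _ _ _ _ I0 J0) as H.
    match type of H with is_RInt _ _ _ ?l => replace l with (2 * PI * v0) in H
      by (unfold plus; simpl; ring) end.
    eapply is_RInt_ext; [| exact H].
    intros t _; unfold plus; simpl; rewrite Rmult_0_l, sin_0, cos_0.
    unfold V; fold (X t) (Y t) v0; unfold X, Y; ring.
  (* Half the sum of the imaginary parts for k = 1 and k = -1 is V cos t; in the next case half the
     difference of the real parts is V sin t. *)
  - pose proof (is_RInt_plus _ _ _ _ _ _
      (is_RInt_scal _ _ _ (/ 2) _ (is_RInt_plus _ _ _ _ _ _ I1' I2')) J1) as H.
    match type of H with is_RInt _ _ _ ?l => replace l with (PI * r * q) in H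
      by (unfold plus, scal; simpl; unfold mult; simpl; field) end.
    eapply is_RInt_ext; [| exact H].
    intros t _; unfold plus, scal; simpl; unfold mult; simpl.
    replace (- 1 * t) with (- t) by ring; rewrite Rmult_1_l, sin_neg, cos_neg.
    unfold V; fold (X t) (Y t) v0; unfold X, Y; field.
  - pose proof (is_RInt_plus _ _ _ _ _ _
      (is_RInt_scal _ _ _ (/ 2) _ (is_RInt_minus _ _ _ _ _ _ I2 I1)) J2) as H.
    match type of H with is_RInt _ _ _ ?l => replace l with (PI * r * p) in H
      by (unfold plus, minus, opp, scal; simpl; unfold plus, opp, mult; simpl; field) end.
    eapply is_RInt_ext; [| exact H].
    intros t _; unfold plus, minus, opp, scal; simpl; unfold plus, opp, mult; simpl.
    replace (- 1 * t) with (- t) by ring; rewrite Rmult_1_l, sin_neg, cos_neg.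
    unfold V; fold (X t) (Y t) v0; unfold X, Y; field.
Qed.

(** * Large circles: the derivative is bounded, then constant *)

Lemma linear_le_const_nonpos (c d : R) : (forall r, 0 < r -> c * r <= d) -> c <= 0.
Proof.
  intros h; destruct (Rle_dec c 0) as [| hc]; [assumption |].
  pose proof (h ((Rabs d + 1) / c) ltac:(apply Rdiv_lt_0_compat; pose proof (Rabs_pos d); lra)) as H.
  replace (c * ((Rabs d + 1) / c)) with (Rabs d + 1) in H by (field; lra).
  pose proof (Rle_abs d); lra.
Qed.

(** Since M - v is nonnegative on the circle, its first Fourier integrals are at most its total
    integral 2 pi (M - v(a, b)), with M = |b| + r. The terms in [r] then give (|z| - 2) r bounded
    independently of r, for z = p and z = q. *)
Lemma derivative_bound (u v : R -> R -> R)
  (hol : forall x y, exists p q, holo_pt u v x y p q)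
  (him : forall x y, v x y <= Rabs y) (a b p q : R) (h0 : holo_pt u v a b p q) :
  Rabs p <= 2 /\ Rabs q <= 2.
Proof.
  pose proof PI_RGT_0 as hPI.
  assert (H : forall r, 0 < r ->
    (Rabs p - 2) * r <= 2 * (Rabs b - v a b) /\ (Rabs q - 2) * r <= 2 * (Rabs b - v a b)).
  { intros r hr.
    destruct (circle_integrals_of_im u v a b p q hol h0 r hr) as [I0 [Ic Is]].
    set (w := fun t => v (a + r * cos t) (b + r * sin t)) in *.
    pose (M := Rabs b + r).
    assert (hM : forall t, w t <= M).
    { intros t; eapply Rle_trans; [apply him |].
      eapply Rle_trans; [apply Rabs_triang |].
      apply Rplus_le_compat_l; rewrite Rabs_mult, (Rabs_pos_eq r) by lra.
      pose proof (SIN_bound t); assert (Rabs (sin t) <= 1) by (apply Rabs_le; lra); nra. }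
    assert (JM : is_RInt (fun t => M - w t) 0 (2 * PI) (2 * PI * (M - v a b))).
    { pose proof (is_RInt_minus _ _ _ _ _ _ (is_RInt_const 0 (2 * PI) M) I0) as H.
      match type of H with is_RInt _ _ _ ?l => replace (2 * PI * (M - v a b)) with l
        by (unfold minus, plus, opp, scal; simpl; unfold mult; simpl; ring) end.
      exact H. }
    (* The weight [e] is sin or cos; its periodic primitive [E] shows that its mean is zero, so
       replacing [w] by [w - M] leaves the coefficient unchanged. *)
    assert (hbound : forall (e E : R -> R) z, (forall t, is_derive E t (e t)) ->
      (forall t, ex_derive e t) -> E (2 * PI) = E 0 -> (forall t, - 1 <= e t <= 1) ->
      is_RInt (fun t => w t * e t) 0 (2 * PI) (PI * r * z) ->
      (Rabs z - 2) * r <= 2 * (Rabs b - v a b)).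
    { intros e E z he he' hE hbd Ie.
      assert (J : is_RInt (fun t => (w t - M) * e t) 0 (2 * PI) (PI * r * z)).
      { assert (K : is_RInt e 0 (2 * PI) (E (2 * PI) - E 0)).
        { apply (is_RInt_derive (V := R_CompleteNormedModule)); intros t _;
            [apply he | apply (ex_derive_continuous (K := R_AbsRing) (V := R_NormedModule)), he']. }
        rewrite hE in K.
        pose proof (is_RInt_minus _ _ _ _ _ _ Ie (is_RInt_scal _ _ _ M _ K)) as H.
        match type of H with is_RInt _ _ _ ?l => replace (PI * r * z) with l
          by (unfold minus, plus, opp, scal; simpl; unfold mult; simpl; ring) end.
        eapply is_RInt_ext; [| exact H].
        intros t _; unfold minus, plus, opp, scal; simpl; unfold mult; simpl; ring. }
      assert (hle : Rabs (PI * r * z) <= 2 * PI * (M - v a b)).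
      { refine (norm_RInt_le (V := R_NormedModule) _ _ 0 (2 * PI) _ _ _ _ J JM); [lra |].
        intros t _; change (Rabs ((w t - M) * e t) <= M - w t).
        rewrite Rabs_mult, Rabs_left1 by (specialize (hM t); lra).
        assert (Rabs (e t) <= 1) by (apply Rabs_le, hbd).
        specialize (hM t); nra. }
      rewrite !Rabs_mult, (Rabs_pos_eq PI), (Rabs_pos_eq r) in hle by lra.
      unfold M in hle.
      assert (r * Rabs z <= 2 * (Rabs b + r - v a b))
        by (apply (Rmult_le_reg_l PI); [lra |]; lra).
      lra. }
    split.
    - apply (hbound sin (fun t => - cos t) p); [ | | | apply SIN_bound | exact Is].
      + intros t; auto_derive; [trivial | ring].
      + intros t; auto_derive; trivial.
      + now rewrite cos_2PI, cos_0.
    - apply (hbound cos sin q); [ | | | apply COS_bound | exact Ic].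
      + intros t; auto_derive; [trivial | ring].
      + intros t; auto_derive; trivial.
      + now rewrite sin_2PI, sin_0. }
  split; apply Rminus_le; eapply linear_le_const_nonpos; intros r hr; apply (H r hr).
Qed.

(** On circles of equal radius r around the two centres, the values of [v] at equal angles differ by
    a bound independent of r, whereas the first Fourier integrals differ by pi r times the
    difference of the derivatives. *)
Lemma derivative_constant (u v : R -> R -> R) (L : R)
  (hol : forall x y, exists p q, holo_pt u v x y p q)
  (hlip : forall a b h k, Rabs (v (a + h) (b + k) - v a b) <= L * (Rabs h + Rabs k))
  (a b p q a' b' p' q' : R) (h1 : holo_pt u v a b p q) (h2 : holo_pt u v a' b' p' q') :
  p = p' /\ q = q'.
Proof.
  pose proof PI_RGT_0 as hPI.
  assert (H : forall r, 0 < r ->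
    Rabs (p - p') * r <= 2 * (L * (Rabs (a - a') + Rabs (b - b'))) /\
    Rabs (q - q') * r <= 2 * (L * (Rabs (a - a') + Rabs (b - b')))).
  { intros r hr.
    destruct (circle_integrals_of_im u v a b p q hol h1 r hr) as [_ [Ic Is]].
    destruct (circle_integrals_of_im u v a' b' p' q' hol h2 r hr) as [_ [Ic' Is']].
    assert (hbound : forall (e : R -> R) z z', (forall t, - 1 <= e t <= 1) ->
      is_RInt (fun t => v (a + r * cos t) (b + r * sin t) * e t) 0 (2 * PI) (PI * r * z) ->
      is_RInt (fun t => v (a' + r * cos t) (b' + r * sin t) * e t) 0 (2 * PI) (PI * r * z') ->
      Rabs (z - z') * r <= 2 * (L * (Rabs (a - a') + Rabs (b - b')))).
    { intros e z z' hbd I I'.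
      pose proof (is_RInt_minus _ _ _ _ _ _ I I') as J.
      apply (norm_RInt_le_const (V := R_NormedModule) _ 0 (2 * PI) _
        (L * (Rabs (a - a') + Rabs (b - b')))) in J; [| lra |].
      - change (Rabs (PI * r * z - PI * r * z')
          <= (2 * PI - 0) * (L * (Rabs (a - a') + Rabs (b - b')))) in J.
        replace (PI * r * z - PI * r * z') with (PI * r * (z - z')) in J by ring.
        rewrite !Rabs_mult, (Rabs_pos_eq PI), (Rabs_pos_eq r) in J by lra.
        apply (Rmult_le_reg_l PI); [lra |]; lra.
      - intros t _.
        change (Rabs (v (a + r * cos t) (b + r * sin t) * e t
          - v (a' + r * cos t) (b' + r * sin t) * e t)
          <= L * (Rabs (a - a') + Rabs (b - b'))).
        rewrite <- Rmult_minus_distr_r, Rabs_mult.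
        pose proof (hlip (a' + r * cos t) (b' + r * sin t) (a - a') (b - b')) as hl.
        replace (a' + r * cos t + (a - a')) with (a + r * cos t) in hl by ring.
        replace (b' + r * sin t + (b - b')) with (b + r * sin t) in hl by ring.
        eapply Rle_trans; [| exact hl].
        assert (Rabs (e t) <= 1) by (apply Rabs_le, hbd).
        pose proof (Rabs_pos (v (a + r * cos t) (b + r * sin t)
          - v (a' + r * cos t) (b' + r * sin t))); nra. }
    split; [apply (hbound sin) | apply (hbound cos)]; auto using SIN_bound, COS_bound. }
  assert (hz : forall z z', Rabs (z - z') <= 0 -> z = z').
  { intros z z' h; pose proof (Rabs_pos (z - z')).
    apply Rminus_diag_uniq, Rabs_eq_0; lra. }
  split; apply hz; eapply linear_le_const_nonpos; intros r hr; apply (H r hr).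
Qed.

(** * From complex derivatives to holomorphic pairs, and the conclusion *)

Lemma is_derive_holo_pt (f : C -> C) (x y : R) (l : C) :
  @is_derive C_AbsRing C_NormedModule f (x, y) l ->
  holo_pt (fun s t => Re (f (s, t))) (fun s t => Im (f (s, t))) x y (Re l) (Im l).
Proof.
  intros [_ hd].
  assert (H : forall eps : posreal, exists delta : posreal, forall s t,
    Rabs (s - x) < delta -> Rabs (t - y) < delta ->
    Cmod (f (s, t) - f (x, y) - ((s, t) - (x, y)) * l)%C
      <= eps * Rmax (Rabs (s - x)) (Rabs (t - y))).
  { intros eps.
    (* The modulus is at most twice the maximum norm, which explains [eps / 2] here and the radius
       [d / 2] below. *)
    assert (h2 : 0 < eps / 2) by (pose proof (cond_pos eps); lra).
    destruct (hd (x, y) (fun P H => H) (mkposreal _ h2)) as [d H].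
    assert (hd2 : 0 < d / 2) by (pose proof (cond_pos d); lra).
    exists (mkposreal _ hd2); intros s t hs ht; simpl in hs, ht.
    assert (hmod : Cmod ((s, t) - (x, y))%C <= 2 * Rmax (Rabs (s - x)) (Rabs (t - y))).
    { eapply Rle_trans; [apply Cmod_2Rmax |]; simpl.
      apply Rmult_le_compat_r.
      - eapply Rle_trans; [apply Rabs_pos | apply Rmax_l].
      - apply Rle_trans with (sqrt (2 * 2)); [apply sqrt_le_1; lra | right; apply sqrt_square; lra]. }
    assert (hmax : Rmax (Rabs (s - x)) (Rabs (t - y)) < d / 2) by now apply Rmax_lub_lt.
    assert (hball : Cmod ((s, t) - (x, y))%C < d) by lra.
    eapply Rle_trans; [exact (H (s, t) hball) |].
    change (eps / 2 * Cmod ((s, t) - (x, y))%C <= eps * Rmax (Rabs (s - x)) (Rabs (t - y))).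
    apply Rle_trans with (eps / 2 * (2 * Rmax (Rabs (s - x)) (Rabs (t - y))));
      [apply Rmult_le_compat_l; lra | right; field]. }
  split; intros eps; destruct (H eps) as [d hdelta]; exists d; intros s t hs ht;
    (eapply Rle_trans; [| exact (hdelta s t hs ht)]);
    (eapply Rle_trans; [| apply Rmax_Cmod]).
  - eapply Rle_trans; [right | apply Rmax_l]; f_equal.
    unfold Cminus, Cplus, Copp, Cmult, Re, Im; simpl; ring.
  - eapply Rle_trans; [right | apply Rmax_r]; f_equal.
    unfold Cminus, Cplus, Copp, Cmult, Re, Im; simpl; ring.
Qed.

Theorem corollary1p1 (omega : C -> C)
  (h_entire : entire omega)
  (h_im : forall k : C, (Im (omega k) <= Rabs (Im k))%R) :
  polynomial_degree_le 1 omega.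
Proof.
  pose (u := fun x y => Re (omega (x, y))); pose (v := fun x y => Im (omega (x, y))).
  pose (p := fun x y => Re (C_derive omega (x, y))).
  pose (q := fun x y => Im (C_derive omega (x, y))).
  assert (hpq : forall x y, holo_pt u v x y (p x y) (q x y)).
  { intros x y; apply is_derive_holo_pt, (C_derive_correct omega (x, y) 0), h_entire. }
  assert (hol : forall x y, exists p q, holo_pt u v x y p q)
    by (intros x y; exists (p x y), (q x y); apply hpq).
  assert (hb : forall x y, Rabs (p x y) <= 2 /\ Rabs (q x y) <= 2).
  { intros x y; apply (derivative_bound u v hol (fun x y => h_im (x, y)) x y), hpq. }
  assert (hlip : forall a b h k, Rabs (v (a + h) (b + k) - v a b) <= 2 * (Rabs h + Rabs k)).
  { apply (differentiable_pt_lim_bound v q p); intros x y; [apply hpq | apply hb | apply hb]. }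
  set (p0 := p 0 0); set (q0 := q 0 0).
  assert (hc : forall x y, p x y = p0 /\ q x y = q0).
  { intros x y; apply (derivative_constant u v 2 hol hlip x y _ _ 0 0); apply hpq. }
  (* Subtracting k times the derivative at 0 leaves a function with zero derivative everywhere; the
     mean value bound with constant 0 then makes both of its parts constant. *)
  assert (hrem : forall x y,
    holo_pt (fun s t => u s t + (0 + - p0 * s - - q0 * t))
      (fun s t => v s t + (0 + - q0 * s + - p0 * t)) x y 0 0).
  { intros x y; destruct (hc x y) as [e1 e2].
    pose proof (holo_pt_plus _ _ _ _ _ _ _ _ _ _ (hpq x y)
      (holo_pt_affine 0 0 (- p0) (- q0) x y)) as H.
    rewrite e1, e2, !Rplus_opp_r in H; exact H. }
  assert (hzero : forall w : R -> R -> R,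
    (forall x y, differentiable_pt_lim w x y 0 0) -> forall x y, w x y = w 0 0).
  { intros w hw x y.
    pose proof (differentiable_pt_lim_bound w (fun _ _ => 0) (fun _ _ => 0) 0 hw
      ltac:(intros; cbv beta; rewrite Rabs_R0; lra) ltac:(intros; cbv beta; rewrite Rabs_R0; lra) 0 0 x y) as h.
    rewrite Rmult_0_l, !Rplus_0_l in h.
    apply Rminus_diag_uniq, Rabs_eq_0; pose proof (Rabs_pos (w x y - w 0 0)); lra. }
  exists (fun i => match i with O => omega (0, 0) | S _ => (p0, q0) end).
  intros [x y].
  rewrite sum_Sn, sum_O; unfold plus; simpl.
  pose proof (hzero _ (fun x y => proj2 (hrem x y)) x y) as ev.
  assert (eu := hzero (fun s t => u s t + (0 + - p0 * s - - q0 * t))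
    ltac:(intros s t; destruct (hrem s t) as [h _]; rewrite Ropp_0 in h; exact h) x y).
  unfold u, v in eu, ev; cbv beta in eu, ev.
  destruct (omega (x, y)) as [a b]; destruct (omega (0, 0)) as [a0 b0].
  unfold Re, Im in eu, ev; simpl in eu, ev.
  unfold Cplus, Cmult; simpl; f_equal; lra.
Qed.
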